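(* Let $X=(X_n)_{n\ge 0}$ be an ergodic (irreducible and aperiodic) discrete-time homogeneous Markov chain on a finite state space $\mathcal{X}$ with transition matrix $P$, stationary distribution $\pi=(\pi_i)_{i\in\mathcal{X}}$, and resistance distance $\Omega=(\Omega_{i,j})_{i,j\in\mathcal{X}}$. Then for all $i,j\in\mathcal{X}$: (1) (Group inverse representation) $$\Omega_{i,j}=D_{i,i}+D_{j,j}-D_{i,j}-D_{j,i},$$ where $D$ is the group inverse of $I-P$. (2) (Mean hitting time representation) $$\Omega_{i,j}=\pi_j\,\mathbb{E}_i(\tau_j)+\pi_i\,\mathbb{E}_j(\tau_i).$$ (3) (Forest representation) $$\Omega_{i,j}=\frac{f_{i,j}+f_{j,i}}{q}.$$ (4) (Commute time representation for doubly stochastic $P$) If $P$ is doubly stochastic, that is, all row sums and all column sums of $P$ equal $1$, then $$\Omega_{i,j}=\frac{1}{|\mathcal{X}|}\,t^{c}_{i,j}.$$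
   Context: Let $\Pi$ be the $|\mathcal{X}|\times|\mathcal{X}|$ matrix each of whose rows is $\pi$, and $I$ the identity matrix of the same size. The fundamental matrix of $X$ is $F=(F_{i,j})_{i,j\in\mathcal X}:=(I-P+\Pi)^{-1}$ (the inverse always exists). The resistance distance of the Markov chain is $\Omega_{i,j}:=F_{i,i}+F_{j,j}-F_{i,j}-F_{j,i}$ for $i,j\in\mathcal{X}$. The group inverse $D=(D_{i,j})_{i,j\in\mathcal{X}}$ of $I-P$ is the matrix satisfying $(I-P)D(I-P)=I-P$, $D(I-P)D=D$ and $(I-P)D=D(I-P)$. In this ergodic setting $D=\sum_{n\ge 0}(P^n-\Pi)$. For $j\in\mathcal{X}$, $\tau_j:=\inf\{n\ge 0: X_n=j\}$ (with $\inf\emptyset=\infty$), and $\mathbb{E}_i$ denotes expectation under $X_0=i$. The commute time between $i$ and $j$ is $t^c_{i,j}:=\mathbb{E}_i(\tau_j)+\mathbb{E}_j(\tau_i)$. Let $G(P)$ be the weighted directed graph on the vertex set $\mathcal{X}$ whose arc weights are the corresponding transition probabilities. The weight of a weighted directed graph is the product of its arc weights (an empty product being $1$), and the weight of a set of weighted directed graphs is the sum of the weights of its members (an empty sum being $0$). A converging tree (in-arborescence, in-tree) rooted at $r$ is a directed tree in which every vertex has a directed path to $r$. An in-forest of $G(P)$ is a spanning subdigraph of $G(P)$ all of whose weak components are converging trees. $f_{i,j}$ is the total weight of the in-forests of $G(P)$ consisting of exactly two trees, such that one tree contains $i$ and the other tree is rooted at $j$ (so $f_{i,i}=0$). $q_j$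 is the total weight of the spanning in-trees of $G(P)$ rooted at $j$, and $q:=\sum_{j\in\mathcal{X}}q_j$. *)

(* Defs.v *)
From HB Require Import structures.
From mathcomp Require Import all_boot all_order all_algebra.
From mathcomp Require Import all_classical all_reals all_analysis.

Set Implicit Arguments.
Unset Strict Implicit.
Unset Printing Implicit Defensive.

Import Order.TTheory GRing.Theory Num.Theory.

Local Open Scope classical_set_scope.
Local Open Scope ring_scope.

Section TransitionMatrix.
Context {R : realType} {n : nat}.
Implicit Types (P A D : 'M[R]_n) (pi : 'rV[R]_n) (i j : 'I_n).

Definition stochastic P : Prop :=
  (forall i j, 0 <= P i j) /\ (forall i, \sum_j P i j = 1).

Definition doubly_stochastic P : Prop :=
  (forall i, \sum_j P i j = 1) /\ (forall j, \sum_i P i j = 1).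

Definition irreducible P : Prop :=
  forall i j, exists k, 0 < (P ^+ k) i j.

(* The gcd of the set of return times {k >= 1 : P^k(i,i) > 0} is 1, the gcd of
   a possibly infinite set being its only common divisor when it equals 1. *)
Definition aperiodic P : Prop :=
  forall i (d : nat),
    (forall k, (0 < k)%N -> 0 < (P ^+ k) i i -> (d %| k)%N) -> d = 1%N.

Definition ergodic P : Prop := irreducible P /\ aperiodic P.

Definition stationary_distribution P pi : Prop :=
  [/\ forall i, 0 <= pi 0 i, \sum_i pi 0 i = 1 & pi *m P = pi].

Definition stationary_matrix pi : 'M[R]_n := \matrix_(i, j) pi 0 j.

Definition fundamental_matrix P pi : 'M[R]_n :=
  invmx (1%:M - P + stationary_matrix pi).

Definition resistance_distance P pi i j : R :=
  let F := fundamental_matrix P pi in F i i + F j j - F i j - F j i.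

Definition is_group_inverse A D : Prop :=
  [/\ A *m D *m A = A, D *m A *m D = D & A *m D = D *m A].

(* Total, like [invmx]: the value 0 is taken when A has no group inverse. *)
Definition group_inverse A : 'M[R]_n :=
  xget 0 [set D | is_group_inverse A D].

Lemma is_group_inverse_unique A D D' :
  is_group_inverse A D -> is_group_inverse A D' -> D = D'.
Proof.
move=> [ADA DAD cD] [AD'A DAD' cD'].
have E : A *m D = A *m D'.
  transitivity (A *m D *m (A *m D')).
    by rewrite cD [in RHS]cD' -mulmxA [A *m (D' *m A)]mulmxA AD'A.
  by rewrite mulmxA ADA.
by rewrite -DAD -mulmxA E mulmxA -cD E cD' DAD'.
Qed.

Lemma group_inverseP A D : is_group_inverse A D -> group_inverse A = D.
Proof.
move=> AD; apply: (is_group_inverse_unique _ AD).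
exact: (xgetPex 0 (ex_intro _ D AD)).
Qed.

End TransitionMatrix.

Section MarkovChain.
Context {R : realType} {n : nat} {d : measure_display} {T : measurableType d}.
Implicit Types (P : 'M[R]_n) (Pr : probability T R) (X : nat -> T -> 'I_n).

Definition history X (x : nat -> 'I_n) (k : nat) : set T :=
  [set w | forall m, (m <= k)%N -> X m w = x m].

(* The last condition is Pr(X_(k+1) = x_(k+1) | X_0 = x_0, ..., X_k = x_k)
   = P(x_k, x_(k+1)) with the denominator cleared, so that conditioning on a
   null event carries no constraint. *)
Definition markov_chain P Pr X : Prop :=
  (forall k x, measurable (X k @^-1` [set x])) /\
  (forall (x : nat -> 'I_n) k,
    Pr (history X x k.+1) = (Pr (history X x k) * (P (x k) (x k.+1))%:E)%E).

Definition starts_at Pr X (i : 'I_n) : Prop := Pr (X 0%N @^-1` [set i]) = 1%E.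

(* [ereal_inf set0 = +oo]. *)
Definition hitting_time X (j : 'I_n) (w : T) : \bar R :=
  ereal_inf [set (k%:R)%:E | k in [set k : nat | X k w = j]].

(* [Pr i] is the law of the chain under the initial condition X_0 = i. *)
Definition mean_hitting_time (Pr : 'I_n -> probability T R) X (i j : 'I_n) :
    \bar R :=
  (\int[Pr i]_w hitting_time X j w)%E.

Definition commute_time (Pr : 'I_n -> probability T R) X (i j : 'I_n) :
    \bar R :=
  (mean_hitting_time Pr X i j + mean_hitting_time Pr X j i)%E.

End MarkovChain.

(* A spanning subdigraph of a digraph on V is represented by its set of arcs. *)
Section Digraph.
Context {V : finType}.
Implicit Types (H G A : {set V * V}) (C : {set V}) (r : V).

Definition arc_rel A : rel V := fun x y => (x, y) \in A.

Definition edge_rel A : rel V := fun x y => ((x, y) \in A) || ((y, x) \in A).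

Definition weak_component A (x : V) : {set V} :=
  [set y | connect (edge_rel A) x y]%SET.

Definition weak_components A : {set {set V}} :=
  [set weak_component A x | x in V]%SET.

Definition induced A C : {set V * V} :=
  [set a in A | (a.1 \in C) && (a.2 \in C)]%SET.

(* The underlying undirected multigraph has no cycle: the three conditions
   exclude cycles of length 1, 2 and at least 3. *)
Definition undirected_acyclic A : Prop :=
  [/\ forall x, (x, x) \notin A,
      forall x y, (x, y) \in A -> (y, x) \notin A
    & forall c : seq V, ucycle (edge_rel A) c -> (size c <= 2)%N].

Definition directed_tree C A : Prop :=
  [/\ A \subset finset.setX C C, C != finset.set0,
      forall x y, x \in C -> y \in C -> connect (edge_rel A) x y
    & undirected_acyclic A].

Definition converging_tree C A r : Prop :=
  [/\ directed_tree C A, r \in C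
    & forall x, x \in C -> connect (arc_rel A) x r].

Definition in_forest G H : Prop :=
  H \subset G /\
  forall C, C \in weak_components H ->
    exists r, converging_tree C (induced H C) r.

Definition spanning_in_tree G r H : Prop :=
  H \subset G /\ converging_tree [set: V]%SET H r.

Definition two_tree_in_forest G i j H : Prop :=
  [/\ in_forest G H, #|weak_components H| = 2%N
    & exists C C', [/\ C \in weak_components H, C' \in weak_components H,
        C != C', i \in C & converging_tree C' (induced H C') j]].

End Digraph.

Section Forests.
Context {R : realType} {n : nat}.
Implicit Types (P : 'M[R]_n) (i j : 'I_n).

Definition transition_digraph P : {set 'I_n * 'I_n} :=
  [set a | 0 < P a.1 a.2]%SET.

Definition weight P (H : {set 'I_n * 'I_n}) : R :=
  \prod_(a in H) P a.1 a.2.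

Definition forest_weight P i j : R :=
  \sum_(H : {set 'I_n * 'I_n}
       | `[< two_tree_in_forest (transition_digraph P) i j H >]) weight P H.

Definition tree_weight P j : R :=
  \sum_(H : {set 'I_n * 'I_n}
       | `[< spanning_in_tree (transition_digraph P) j H >]) weight P H.

Definition total_tree_weight P : R := \sum_j tree_weight P j.

End Forests.

(* Main.v *)
Require Import Defs.
From HB Require Import structures.
From mathcomp Require Import all_boot all_order all_algebra.
From mathcomp Require Import all_classical all_reals all_analysis.
From mathcomp Require Import ring.

(** Everything goes through one equation. Write [L = I - P] for the Laplacian of
the chain. By the maximum principle ([harmonic_constant]) the only functions
killed by [L] are the constants, so [I - P + Pi] is invertible, and its inverse
[F] satisfies [L F = F L = I - Pi]. Hence [F - Pi] is the group inverse of [L]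
([group_inverse_laplacian]); the second difference defining the resistance
distance does not see the term [Pi], whose rows are all equal.

Hitting times. Fix [j]. The function [h x = (F j j - F x j) / pi j] vanishes at
[j], and column [j] of [L F = I - Pi] says that [h = 1 + P h] elsewhere. For
such an [h], the sub-probabilities [a_m] of the chain killed at
[j] telescope: [a_(m+1) . h = a_m . h - a_m . 1], so the survival probabilities
[a_m . 1] add up to [h i] as soon as [a_m . h] tends to 0. Boundedness of [h]
makes the series converge, which in turn forces [a_m . h] to 0. Since the mean
of the hitting time is the sum of the survival probabilities, it equals [h i]
([integral_hitting_time], [sum_unhit]).

Forests. An in-forest is encoded by the map sending each vertex to its successor
and each root to itself; the roots are then the fixed points, and every vertex
reaches one by iteration. Two surgeries on such maps prove that [f_(.,j)] solves
[L f = q_j 1 - q e_j] ([forest_sum_poisson]):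
- cutting the arc leaving [j] turns a tree rooted at [r <> j] into a forest with
  roots [r] and [j] together with a vertex [k] of the tree of [r], the former
  successor of [j] ([cut_sum]);
- exchanging the successor of [i] with a marked vertex [k] is an involution on
  the pairs (forest, [k]); it swaps the configurations where [i] is in the tree
  of [r] and [k] in that of [j] with the opposite ones ([swap_sum]).
Pairing the equation with [pi] gives the Markov chain tree theorem
[q_j = q pi_j]. The right-hand side is then [q] times that of the equation for
[F j j - F . j], so the maximum principle identifies [f_(i,j)] with
[q (F j j - F i j)] ([forest_sum_fundamental]). Finally [q > 0] because shortest
paths in an irreducible chain form a tree.

For a doubly stochastic chain, [pi] is uniform by uniqueness, and the hitting
time formula becomes the commute time formula. *)

Set Implicit Arguments.
Unset Strict Implicit.
Unset Printing Implicit Defensive.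

Import Order.TTheory GRing.Theory Num.Theory.
Import numFieldNormedType.Exports.

Local Open Scope ring_scope.

(** * Potential theory of an irreducible chain *)

Section Potential.
Context {R : realType} {n : nat} (P : 'M[R]_n) (pi : 'rV[R]_n).
Hypothesis P_stochastic : stochastic P.
Hypothesis P_irreducible : irreducible P.
Hypothesis pi_stationary : stationary_distribution P pi.

Let Pi := stationary_matrix pi.
Let F := fundamental_matrix P pi.

Lemma stochastic_ge0_exp k i j : 0 <= (P ^+ k) i j.
Proof.
elim: k i j => [|k IH] i j; first by rewrite expr0 mxE ler0n.
rewrite exprS mxE; apply: sumr_ge0 => l _.
by rewrite mulr_ge0 ?IH ?(P_stochastic.1).
Qed.

Lemma stochastic_mulr_const1 : P *m const_mx 1 = const_mx 1 :> 'cV[R]_n.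
Proof.
apply/matrixP => i j; rewrite !mxE -[RHS](P_stochastic.2 i).
by apply: eq_bigr => l _; rewrite mxE mulr1.
Qed.

Lemma invariant_mulr_exp (m : nat) (M : 'M[R]_n) (v : 'M[R]_(n, m)) k :
  M *m v = v -> (M ^+ k) *m v = v.
Proof.
move=> Mv; elim: k => [|k IH]; first by rewrite expr0 mul1mx.
by rewrite exprSr -mulmxA Mv IH.
Qed.

Lemma stationary_mulr_exp k : pi *m P ^+ k = pi.
Proof.
have [_ _ piP] := pi_stationary.
elim: k => [|k IH]; first by rewrite expr0 mulmx1.
by rewrite exprS mulmxA piP IH.
Qed.

(** Stationarity is orthogonality to the range of [I - P]. *)
Lemma stationary_laplacian (f : 'I_n -> R) :
  \sum_i pi 0 i * (f i - \sum_k P i k * f k) = 0.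
Proof.
have [_ _ piP] := pi_stationary.
under eq_bigr do rewrite mulrBr mulr_sumr.
rewrite sumrB [X in _ - X]exchange_big /=; apply/eqP; rewrite subr_eq0; apply/eqP.
apply: eq_bigr => k _; under eq_bigr do rewrite mulrA.
by rewrite -mulr_suml; congr (_ * _); rewrite -{1}piP mxE.
Qed.

Lemma stochastic_row_sum_exp k i : \sum_j (P ^+ k) i j = 1.
Proof.
have /matrixP/(_ i 0) := invariant_mulr_exp k stochastic_mulr_const1.
by rewrite !mxE => <-; apply: eq_bigr => j _; rewrite mxE mulr1.
Qed.

(** At a maximum point [m] of [h], the averages [P^k h (m) = h m] leave no room
for a smaller value at a vertex charged by the row of [m] in some [P^k], and
irreducibility makes this every vertex. *)
Lemma harmonic_constant (h : 'cV[R]_n) :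
  P *m h = h -> forall x y, h x 0 = h y 0.
Proof.
move=> Ph; suff H m : (forall z, h z 0 <= h m 0) -> forall y, h y 0 = h m 0.
  move=> x y.
  have [m _ mP] := @Order.TotalTheory.arg_maxP _ _ _ x xpredT (fun z => h z 0) isT.
  by rewrite !(H m) // => z; apply: mP.
move=> hm y; have [k Pk] := P_irreducible m y.
have E : \sum_z (P ^+ k) m z * (h m 0 - h z 0) = 0.
  under eq_bigr do rewrite mulrBr.
  rewrite sumrB -mulr_suml stochastic_row_sum_exp mul1r.
  have /matrixP/(_ m 0) := invariant_mulr_exp k Ph.
  by rewrite mxE => ->; rewrite subrr.
have ge0 z : xpredT z -> 0 <= (P ^+ k) m z * (h m 0 - h z 0).
  by move=> _; rewrite mulr_ge0 ?stochastic_ge0_exp// subr_ge0.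
have /eqP := psumr_eq0P ge0 E (i := y) isT.
by rewrite mulf_eq0 gt_eqF//= subr_eq0 => /eqP.
Qed.

Let M := 1%:M - P + Pi.

Lemma mul_stationary_matrix (m : nat) (v : 'M[R]_(n, m)) i j :
  (Pi *m v) i j = (pi *m v) 0 j.
Proof. by rewrite !mxE; apply: eq_bigr => l _; rewrite mxE. Qed.

Lemma stationary_mul_Pi : pi *m Pi = pi.
Proof.
have [_ pi1 _] := pi_stationary.
apply/rowP => j; rewrite !mxE; under eq_bigr do rewrite mxE.
by rewrite -mulr_suml pi1 mul1r.
Qed.

Lemma stationary_mul_M : pi *m M = pi.
Proof.
have [_ _ piP] := pi_stationary.
by rewrite mulmxDr mulmxBr mulmx1 piP subrr add0r stationary_mul_Pi.
Qed.

(** A column [w] killed by [I - P + Pi] is killed by [pi], hence by [Pi] and by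
[I - P]; it is then constant, with [pi]-mean 0. *)
Lemma fundamental_unit : M \in unitmx.
Proof.
rewrite -unitmx_tr -row_free_unit -kermx_eq0; apply/eqP/row_matrixP => i.
rewrite row0; set w := row i _; have wM : w *m M^T = 0.
  by rewrite -row_mul mulmx_ker row0.
clearbody w.
have Mw : M *m w^T = 0 by rewrite -[M]trmxK -trmx_mul wM trmx0.
have piw : pi *m w^T = 0 by rewrite -stationary_mul_M -mulmxA Mw mulmx0.
have Piw : Pi *m w^T = 0.
  by apply/matrixP => k l; rewrite mul_stationary_matrix piw !mxE.
have Pw : P *m w^T = w^T.
  apply/eqP; rewrite eq_sym -subr_eq0 -{1}[w^T]mul1mx -mulmxBl.
  by rewrite -[_ *m _]addr0 -{1}Piw -mulmxDl Mw.
have cw := harmonic_constant Pw.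
apply/rowP => l; rewrite [RHS]mxE.
have [_ pi1 _] := pi_stationary.
move/matrixP/(_ 0 0): piw; rewrite !mxE.
under eq_bigr do rewrite (cw _ l) mxE.
by rewrite -mulr_suml pi1 mul1r.
Qed.

Lemma P_mul_Pi : P *m Pi = Pi.
Proof.
apply/matrixP => i j; rewrite !mxE -[RHS]mul1r -(P_stochastic.2 i) mulr_suml.
by apply: eq_bigr => l _; rewrite mxE.
Qed.

Lemma Pi_mul_Pi : Pi *m Pi = Pi.
Proof.
by apply/matrixP => i j; rewrite mul_stationary_matrix stationary_mul_Pi mxE.
Qed.

Lemma M_mul_Pi : M *m Pi = Pi.
Proof. by rewrite mulmxDl mulmxBl mul1mx P_mul_Pi subrr add0r Pi_mul_Pi. Qed.

Lemma Pi_mul_M : Pi *m M = Pi.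
Proof.
by apply/matrixP => i j; rewrite mul_stationary_matrix stationary_mul_M mxE.
Qed.

Lemma fundamental_mul_Pi : F *m Pi = Pi.
Proof. by rewrite -{1}M_mul_Pi mulmxA mulVmx ?mul1mx// fundamental_unit. Qed.

Lemma Pi_mul_fundamental : Pi *m F = Pi.
Proof. by rewrite -{1}Pi_mul_M -mulmxA mulmxV ?mulmx1// fundamental_unit. Qed.

Lemma laplacian_mul_fundamental : (1%:M - P) *m F = 1%:M - Pi.
Proof.
rewrite -[1%:M - P](addrK Pi) mulmxBl Pi_mul_fundamental.
by rewrite mulmxV// fundamental_unit.
Qed.

Lemma fundamental_mul_laplacian : F *m (1%:M - P) = 1%:M - Pi.
Proof.
rewrite -[1%:M - P](addrK Pi) mulmxBr fundamental_mul_Pi.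
by rewrite mulVmx// fundamental_unit.
Qed.

Lemma group_inverse_laplacian : group_inverse (1%:M - P) = F - Pi.
Proof.
have AD : (1%:M - P) *m (F - Pi) = 1%:M - Pi.
  rewrite mulmxBr laplacian_mul_fundamental mulmxBl mul1mx P_mul_Pi.
  by rewrite subrr subr0.
have PiA : Pi *m (1%:M - P) = 0.
  apply/matrixP => i j; have [_ _ piP] := pi_stationary.
  by rewrite mul_stationary_matrix mulmxBr mulmx1 piP subrr !mxE.
have DA : (F - Pi) *m (1%:M - P) = 1%:M - Pi.
  by rewrite mulmxBl fundamental_mul_laplacian PiA subr0.
apply: group_inverseP; split.
- by rewrite AD mulmxBl mul1mx PiA subr0.
- rewrite DA mulmxBl mul1mx mulmxBr Pi_mul_fundamental Pi_mul_Pi.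
  by rewrite subrr subr0.
- by rewrite AD DA.
Qed.

Lemma resistance_distance_group_inverse i j :
  let D := group_inverse (1%:M - P) in
  resistance_distance P pi i j = D i i + D j j - D i j - D j i.
Proof.
rewrite /= group_inverse_laplacian /resistance_distance -/F !mxE.
by ring.
Qed.

Lemma laplacian_fundamentalE i j :
  F i j - \sum_k P i k * F k j = (i == j)%:R - pi 0 j.
Proof.
have /matrixP/(_ i j) := laplacian_mul_fundamental.
by rewrite mulmxBl mul1mx !mxE.
Qed.

Lemma stationary_gt0 j : 0 < pi 0 j.
Proof.
have [pi0 pi1 _] := pi_stationary.
have [i pii] : exists i, 0 < pi 0 i.
  apply/existsP; apply: contraT; rewrite negb_exists => /forallP npi.
  have : \sum_i pi 0 i = 0.
    by apply: big1 => i _; apply/eqP; rewrite eq_le pi0 andbT leNgt npi.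
  by rewrite pi1 => /eqP; rewrite oner_eq0.
have [k Pk] := P_irreducible i j.
rewrite -(stationary_mulr_exp k) mxE (bigD1 i)//= ltr_wpDr ?mulr_gt0//.
by apply: sumr_ge0 => l _; rewrite mulr_ge0 ?stochastic_ge0_exp.
Qed.

(** All stationary distributions have the same image under the invertible
[I - P + Pi]. *)
Lemma stationary_unique (mu : 'rV[R]_n) :
  \sum_i mu 0 i = 1 -> mu *m P = mu -> mu = pi.
Proof.
move=> mu1 muP; have muPi : mu *m Pi = pi.
  apply/rowP => j; rewrite !mxE; under eq_bigr do rewrite mxE.
  by rewrite -mulr_suml mu1 mul1r.
have muM : mu *m M = pi *m M.
  by rewrite stationary_mul_M mulmxDr mulmxBr mulmx1 muP subrr add0r.
by rewrite -(mulmxK fundamental_unit mu) muM mulmxK// fundamental_unit.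
Qed.

End Potential.

(** * Rooted forests as maps: cutting and swapping an arc *)

Section RootedMaps.
Context {V : finType}.
Implicit Types (phi : {ffun V -> V}) (x y i j k r s : V).

(** The in-forests with root set [S]: a vertex is sent to its successor, and a
root to itself. The second clause makes the elements of [S] the only fixed
points and excludes every other cycle. *)
Definition rooted_map (S : {set V}) phi :=
  [forall s in S, phi s == s] &&
  [forall x, [exists s in S, fconnect phi x s]].

Definition redirect phi i k : {ffun V -> V} :=
  [ffun x => if x == i then k else phi x].

Lemma rooted_mapP (S : {set V}) phi :
  reflect ((forall s, s \in S -> phi s = s) /\
           (forall x, exists2 s, s \in S & fconnect phi x s))
          (rooted_map S phi).
Proof.
apply: (iffP andP) => -[fS cS]; split.
- by move=> s sS; apply/eqP; move/forall_inP: fS => /(_ s sS).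
- by move=> x; move/forallP: cS => /(_ x)/exists_inP.
- by apply/forall_inP => s /fS ->.
- by apply/forallP => x; apply/exists_inP.
Qed.

Lemma iter_fixed (f : V -> V) s m : f s = s -> iter m f s = s.
Proof. by move=> fs; elim: m => //= m ->. Qed.

Lemma fconnect_fixed (f : V -> V) s y : f s = s -> fconnect f s y -> y = s.
Proof. by move=> fs /iter_findex <-; rewrite iter_fixed. Qed.

Lemma fconnect_fixed_unique (f : V -> V) x s s' : f s = s -> f s' = s' ->
  fconnect f x s -> fconnect f x s' -> s = s'.
Proof.
move=> fs fs' /iter_findex xs /iter_findex xs'.
case: (leqP (findex f x s) (findex f x s')) => [le|/ltnW le].
  by rewrite -xs' -(subnK le) iterD xs iter_fixed.
by rewrite -xs -(subnK le) iterD xs' iter_fixed.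
Qed.

(** The iterates of a periodic point form a cycle, which cannot contain a fixed
point besides [i] itself. *)
Lemma periodic_fixed (f : V -> V) i s : f s = s ->
  fconnect f i s -> fconnect f (f i) i -> s = i.
Proof.
move=> fs /iter_findex is_ /iter_findex per.
set m := findex f i s in is_; set t := findex f (f i) i in per.
have perm a : iter (a * t.+1) f i = i.
  by elim: a => // a IH; rewrite mulSn iterD IH iterSr.
rewrite -(perm m) mulnS addnC iterD is_ iter_fixed//.
Qed.

Lemma redirect_same phi i k : redirect phi i k i = k.
Proof. by rewrite ffunE eqxx. Qed.

Lemma fconnect_redirect1 phi i k : fconnect (redirect phi i k) i k.
Proof. by have := fconnect1 (redirect phi i k) i; rewrite redirect_same. Qed.

Lemma redirect_other phi i k x : x != i -> redirect phi i k x = phi x.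
Proof. by rewrite ffunE => /negPf ->. Qed.

Lemma redirect_redirect phi i k l :
  redirect (redirect phi i k) i l = redirect phi i l.
Proof. by apply/ffunP => x; rewrite !ffunE; case: eqP. Qed.

Lemma redirect_id phi i : redirect phi i (phi i) = phi.
Proof. by apply/ffunP => x; rewrite !ffunE; case: eqP => // ->. Qed.

(** A path is not affected by the new arc until it meets [i]. *)
Lemma fconnect_redirect phi i k x s : fconnect phi x s ->
  fconnect (redirect phi i k) x s \/
  fconnect phi x i /\ fconnect (redirect phi i k) x i.
Proof.
move=> /iter_findex <-; elim: (findex _ _ _) => [|m [IH|]].
- by left; rewrite connect0.
- have [E|ni] := eqVneq (iter m phi x) i.
    by right; rewrite -{3}E; split=> //; rewrite -E fconnect_iter.
  left; apply: (connect_trans IH); rewrite iterS -(redirect_other _ k ni).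
  exact: fconnect1.
- by right.
Qed.

(** The path from [k] to [j] avoids [i], as otherwise [i] would be in both trees,
and the path from [phi i] to [r] avoids [i] too, as otherwise [i] would lie on a
cycle. Both therefore survive the redirection of [i] to [k]. *)
Lemma rooted_swap r j i k phi : i != r -> i != j -> r != j ->
  rooted_map [set r; j] phi -> fconnect phi i r -> fconnect phi k j ->
  [/\ rooted_map [set r; j] (redirect phi i k),
      fconnect (redirect phi i k) i j & fconnect (redirect phi i k) (phi i) r].
Proof.
move=> ir ij rj /rooted_mapP[fS cS] cir ckj.
have fr : phi r = r by apply: fS; rewrite !inE eqxx.
have fj : phi j = j by apply: fS; rewrite !inE eqxx orbT.
set psi := redirect phi i k.
have ckj' : fconnect psi k j.
  case: (fconnect_redirect i k ckj) => // -[cki _].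
  have := fconnect_fixed_unique fr fj (connect_trans cki cir) ckj.
  by move/eqP; rewrite (negPf rj).
have cij' : fconnect psi i j.
  exact: connect_trans (fconnect_redirect1 _ _ _) ckj'.
split=> //.
  apply/rooted_mapP; split=> [s|x].
    by rewrite !inE => /orP[]/eqP->; rewrite redirect_other// eq_sym.
  have [s sS xs] := cS x.
  case: (fconnect_redirect i k xs) => [xs'|[_ xi]]; first by exists s.
  by exists j; [rewrite !inE eqxx orbT|exact: connect_trans cij'].
have cfir : fconnect phi (phi i) r.
  by move: cir; rewrite fconnect_eqVf (negPf ir).
case: (fconnect_redirect i k cfir) => // -[cfi _].
by move: ir; rewrite (periodic_fixed fr cir cfi) eqxx.
Qed.

(** Grafting the root [j] onto [k] gives a tree rooted at [r] when [k] is in the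
tree of [r], and creates a cycle through [j] when [k] is in the tree of [j]. *)
Lemma rooted_cut r j k phi : r != j ->
  rooted_map [set r] (redirect phi j k) && (phi j == j) =
  rooted_map [set r; j] phi && fconnect phi k r.
Proof.
move=> rj; have [pjj|pjj] := eqVneq (phi j) j; last first.
  rewrite andbF; apply/esym/negP => /andP[/rooted_mapP[fS _] _].
  by move: pjj; rewrite fS ?eqxx// !inE eqxx orbT.
rewrite andbT; set psi := redirect phi j k.
have Ephi : phi = redirect psi j j by rewrite redirect_redirect -{2}pjj redirect_id.
apply/idP/andP => [/rooted_mapP[fS cS]|[/rooted_mapP[fS cS] ckr]].
  have fr : psi r = r by apply: fS; rewrite inE.
  have cr x : fconnect psi x r by have [s /set1P ->] := cS x.
  split.
    apply/rooted_mapP; split=> [s|x].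
      by rewrite !inE => /orP[]/eqP->//; rewrite Ephi redirect_other.
    rewrite Ephi; case: (fconnect_redirect j j (cr x)) => [|[_]] H.
      by exists r; rewrite // !inE eqxx.
    by exists j; rewrite // !inE eqxx orbT.
  rewrite Ephi; case: (fconnect_redirect j j (cr k)) => // -[ckj _].
  have : fconnect psi (psi j) j by rewrite redirect_same.
  by move/(periodic_fixed fr (cr j))/eqP; rewrite (negPf rj).
have fr : phi r = r by apply: fS; rewrite !inE eqxx.
have ckr' : fconnect psi k r.
  case: (fconnect_redirect j k ckr) => // -[ckj _].
  by move: rj; rewrite (fconnect_fixed_unique fr pjj ckr ckj) eqxx.
have cjr : fconnect psi j r.
  exact: connect_trans (fconnect_redirect1 _ _ _) ckr'.
apply/rooted_mapP; split=> [s /set1P ->|x]; first by rewrite redirect_other.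
exists r; first by rewrite inE.
have [s + xs] := cS x; rewrite !inE => /orP[]/eqP Es; subst s.
  case: (fconnect_redirect j k xs) => // -[_ xj]; exact: connect_trans cjr.
case: (fconnect_redirect j k xs) => [xj|[_ xj]]; exact: connect_trans cjr.
Qed.

Lemma rooted_fixed (S : {set V}) phi x :
  rooted_map S phi -> (phi x == x) = (x \in S).
Proof.
move=> /rooted_mapP[fS cS]; apply/eqP/idP => [px|/fS//].
by have [s sS /(fconnect_fixed px) <-] := cS x.
Qed.

Lemma rooted2_connect r j phi x : r != j -> rooted_map [set r; j] phi ->
  fconnect phi x j = ~~ fconnect phi x r.
Proof.
move=> rj rphi; have [fS cS] := rooted_mapP _ _ rphi.
have fr : phi r = r by apply: fS; rewrite !inE eqxx.
have fj : phi j = j by apply: fS; rewrite !inE eqxx orbT.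
apply/idP/idP => [xj|nxr].
  by apply/negP => xr; rewrite (fconnect_fixed_unique fr fj xr xj) eqxx in rj.
by have [s] := cS x; rewrite !inE => /orP[]/eqP-> // xr; rewrite xr in nxr.
Qed.

End RootedMaps.

Section ForestSums.
Context {K : comPzRingType} {V : finType} (p : V -> V -> K).
Implicit Types (phi : {ffun V -> V}) (x y i j k r s : V).

(** Roots contribute no arc, whence the restriction to vertices that move. *)
Definition map_weight phi : K := \prod_(x | phi x != x) p x (phi x).

Definition tree_sum r : K := \sum_(phi | rooted_map [set r] phi) map_weight phi.

(** The forests counted by [f_(i,j)], sorted by the root [r] of the tree of
[i]. *)
Definition forest_sum i j : K :=
  \sum_(r | r != j)
    \sum_(phi | rooted_map [set r; j] phi && fconnect phi i r)
      map_weight phi.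

Lemma rooted_map_weight (S : {set V}) phi : rooted_map S phi ->
  map_weight phi = \prod_(x | x \notin S) p x (phi x).
Proof.
by move=> rphi; apply: eq_bigl => x; rewrite (rooted_fixed _ rphi).
Qed.

(** The trees rooted at [r] are in bijection with the pairs made of a forest
rooted at [r] and [j] and a vertex [k] of the tree of [r]: [k] is the successor
of [j] in the tree, and the arc from [j] to [k] accounts for the factor
[p j k]. *)
Lemma cut_sum r j : r != j ->
  \sum_k p j k *
    (\sum_(phi | rooted_map [set r; j] phi && fconnect phi k r)
      map_weight phi) = tree_sum r.
Proof.
move=> rj; under eq_bigr do rewrite mulr_sumr.
rewrite pair_big_dep /= /tree_sum.
(* the inverse map makes [j] a root and records its former successor *)
rewrite (reindex_onto (fun q : V * {ffun V -> V} => redirect q.2 j q.1)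
  (fun phi => (phi j, redirect phi j j))) /=; last first.
  by move=> phi _; rewrite redirect_redirect redirect_id.
apply: eq_big => [[k phi]|[k phi]] /=.
  rewrite -rooted_cut//; congr (_ && _).
  rewrite xpair_eqE redirect_same eqxx redirect_redirect /=.
  apply/eqP/eqP => [pj|<-]; last by rewrite redirect_same.
  by rewrite -{2}pj redirect_id.
move=> H; have := H; rewrite -rooted_cut// => /andP[H' _].
case/andP: H => H _; rewrite (rooted_map_weight H) (rooted_map_weight H').
rewrite [RHS](bigD1 j) /=; last by rewrite inE eq_sym.
rewrite redirect_same; congr (_ * _); apply: eq_big => [x|x].
  by rewrite !inE negb_or.
by rewrite !inE negb_or => /andP[_ xj]; rewrite redirect_other.
Qed.

(** Exchanging [k] with the successor of [i] is an involution on the pairs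
([k], forest) that preserves [p i k * map_weight phi] and exchanges the two
index sets. *)
Lemma swap_sum r j i : i != r -> i != j -> r != j ->
  \sum_k p i k *
    (\sum_(phi | [&& rooted_map [set r; j] phi, fconnect phi i r
                   & fconnect phi k j]) map_weight phi) =
  \sum_k p i k *
    (\sum_(phi | [&& rooted_map [set r; j] phi, fconnect phi i j
                   & fconnect phi k r]) map_weight phi).
Proof.
move=> ir ij rj.
under eq_bigr do rewrite mulr_sumr; rewrite pair_big_dep /=.
under [RHS]eq_bigr do rewrite mulr_sumr; rewrite pair_big_dep /=.
(* the successor of [i] trades places with the marked vertex *)
pose sw (q : V * {ffun V -> V}) := (q.2 i, redirect q.2 i q.1).
have swK : involutive sw.
  by case=> k phi; rewrite /sw /= redirect_same redirect_redirect redirect_id.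
have swP a b k phi : i != a -> i != b -> a != b ->
    [&& rooted_map [set a; b] phi, fconnect phi i a & fconnect phi k b] ->
    [&& rooted_map [set a; b] (redirect phi i k),
      fconnect (redirect phi i k) i b & fconnect (redirect phi i k) (phi i) a].
  move=> ia ib ab /and3P[H1 H2 H3].
  by have [-> -> ->] := rooted_swap ia ib ab H1 H2 H3.
rewrite [RHS](reindex_onto sw sw) => [|q _]; last exact: swK.
apply: eq_big => [[k phi]|[k phi]] /=.
  rewrite swK eqxx andbT; apply/idP/idP => [|H]; first exact: swP.
  rewrite eq_sym in rj; rewrite finset.setUC in H.
  have := swP _ _ _ _ ij ir rj H.
  by rewrite redirect_redirect redirect_id redirect_same finset.setUC.
move=> H; have /and3P[rphi _ _] := H.
have /and3P[rpsi _ _] := swP _ _ _ _ ir ij rj H.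
have iS : i \notin [set r; j] by rewrite !inE negb_or ir.
rewrite (rooted_map_weight rphi) (rooted_map_weight rpsi).
rewrite (bigD1 i)//= [in RHS](bigD1 i)//= redirect_same mulrCA; congr (_ * (_ * _)).
by apply: eq_bigr => x /andP[_ xi]; rewrite redirect_other.
Qed.

Let forests r j (c : pred {ffun V -> V}) :=
  \sum_(phi | rooted_map [set r; j] phi && c phi) map_weight phi.

(** Only the forests that separate [i] from [k] contribute to the difference. *)
Let forests_diff r j i k : r != j ->
  forests r j (fun phi => fconnect phi i r) -
  forests r j (fun phi => fconnect phi k r) =
  forests r j (fun phi => fconnect phi i r && fconnect phi k j) -
  forests r j (fun phi => fconnect phi i j && fconnect phi k r).
Proof.
move=> rj; rewrite /forests (bigID (fun phi : {ffun V -> V} => fconnect phi k j)) /=.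
rewrite [X in _ - X](bigID (fun phi : {ffun V -> V} => fconnect phi i j)) /=.
have -> : \sum_(phi | (rooted_map [set r; j] phi && fconnect phi i r) &&
                       ~~ fconnect phi k j) map_weight phi =
          \sum_(phi | (rooted_map [set r; j] phi && fconnect phi k r) &&
                       ~~ fconnect phi i j) map_weight phi.
  apply: eq_bigl => phi.
  case rphi: (rooted_map _ phi) => //=; rewrite !(rooted2_connect _ rj)//.
  by rewrite !negbK andbC.
rewrite opprD addrACA subrr addr0; congr (_ - _); apply: eq_bigl => phi.
  by rewrite andbA.
by rewrite -andbA [X in _ && X]andbC.
Qed.

Lemma forest_sum_diag j : forest_sum j j = 0.
Proof.
apply: big1 => r rj; apply: big1 => phi /andP[rphi].
have [fS _] := rooted_mapP _ _ rphi.
have fj : phi j = j by apply: fS; rewrite !inE eqxx orbT.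
by move/(fconnect_fixed fj)/eqP; rewrite (negPf rj).
Qed.

(** For each root [r] other than [j], the difference between [i] and [k] comes
from forests separating them. When [r] is neither [i] nor [j], the two kinds of
separation cancel by [swap_sum]; when [r = i], cutting the trees rooted at [j]
just after [i] produces the one surviving kind. *)
Lemma forest_sum_laplacian i j : i != j ->
  \sum_k p i k * (forest_sum i j - forest_sum k j) = tree_sum j.
Proof.
move=> ij.
under eq_bigr do rewrite /forest_sum -sumrB mulr_sumr.
rewrite exchange_big /= (bigD1 i)//= [X in _ + X]big1 ?addr0 => [|r /andP[rj ri]].
  rewrite -(cut_sum (r := j) (j := i)); last by rewrite eq_sym.
  apply: eq_bigr => k _; congr (_ * _); rewrite forests_diff// /forests.
  rewrite [X in _ - X]big1 ?subr0 => [|phi /and3P[rphi cij _]].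
    by apply: eq_bigl => phi; rewrite connect0 finset.setUC.
  have [fS _] := rooted_mapP _ _ rphi.
  have fi : phi i = i by apply: fS; rewrite !inE eqxx.
  by move: ij; rewrite (fconnect_fixed fi cij) eqxx.
under eq_bigr do rewrite forests_diff// mulrBr.
rewrite sumrB swap_sum ?subrr// eq_sym//.
Qed.

Lemma forest_sum_laplacian_diag j :
  \sum_k p j k * forest_sum k j = \sum_(r | r != j) tree_sum r.
Proof.
under eq_bigr do rewrite mulr_sumr.
by rewrite exchange_big /=; apply: eq_bigr => r rj; rewrite cut_sum.
Qed.

End ForestSums.

(** * Arc sets of in-forests and their successor maps *)

Section TreeStructure.
Context {V : finType}.
Implicit Types (A G H : {set V * V}) (C : {set V}) (x y z r : V).

Lemma edge_rel_sym A : symmetric (edge_rel A).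
Proof. by move=> x y; rewrite /edge_rel orbC. Qed.

Lemma arc_relW A : subrel (arc_rel A) (edge_rel A).
Proof. by move=> x y; rewrite /edge_rel /arc_rel => ->. Qed.

Lemma connect_uniqP (e : rel V) x y : connect e x y ->
  exists p, [/\ path e x p, uniq (x :: p) & y = last x p].
Proof. by move=> /connectP[p0 /shortenP[p]]; exists p. Qed.

(** A directed path from [y] back to [x], closed by the arc from [x] to [y],
would be a loop, a pair of opposite arcs, or an undirected cycle of length at
least 3. *)
Lemma acyclic_no_return A x y :
  undirected_acyclic A -> (x, y) \in A -> ~~ connect (arc_rel A) y x.
Proof.
move=> [loop two cyc] xy; apply/negP => /connect_uniqP[p [pp up Ex]].
have /cyc : ucycle (edge_rel A) (y :: p).
  rewrite /ucycle up andbT /= rcons_path (sub_path (@arc_relW A) pp)/=.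
  by apply: arc_relW; rewrite -Ex.
case: p pp up Ex => [|z [|//]] /= pp _ Ex _.
  by move: (loop y); rewrite -{1}Ex xy.
by move: pp; rewrite andbT /arc_rel -Ex; apply/negP/two.
Qed.

(** By [acyclic_no_return] neither path to [r] comes back to [x]. Joined together
they link [y] to [z] outside [x], and would close up through [x] into a cycle of
length at least 3 if [y] and [z] were distinct. *)
Lemma acyclic_arc_unique A x y z r : undirected_acyclic A ->
  (x, y) \in A -> (x, z) \in A ->
  connect (arc_rel A) y r -> connect (arc_rel A) z r -> y = z.
Proof.
move=> acyc xy xz yr zr; apply/eqP; apply: contraT => nyz.
have [_ _ cyc] := acyc.
(* the underlying undirected graph with the vertex [x] deleted *)
pose e' : rel V := fun u v => [&& edge_rel A u v, u != x & v != x].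
have e'sym : symmetric e'.
  by move=> u v; rewrite /e' edge_rel_sym; congr (_ && _); rewrite andbC.
have avoid u : connect (arc_rel A) u r -> ~~ connect (arc_rel A) u x ->
    connect e' u r.
  move=> /connectP[p]; elim: p u => [|a p IH] u /=.
    by move=> _ -> _; rewrite connect0.
  move=> /andP[ua pa] Er nux.
  have nax : ~~ connect (arc_rel A) a x.
    by apply: contra nux; apply: connect_trans; rewrite connect1.
  apply: connect_trans (IH _ pa Er nax); apply: connect1.
  rewrite /e' /edge_rel; rewrite /arc_rel in ua; rewrite ua /=.
  by apply/andP; split; [apply: contraNneq nux|apply: contraNneq nax] => ->;
    rewrite connect0.
have yz : connect e' y z.
  apply: connect_trans (avoid y yr (acyclic_no_return acyc xy)) _.
  rewrite (sym_connect_sym e'sym).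
  exact: avoid z zr (acyclic_no_return acyc xz).
have nyx : y != x.
  by apply: contraNneq (acyclic_no_return acyc xy) => ->; rewrite connect0.
have [p [pp up Ez]] := connect_uniqP yz.
have xp : x \notin y :: p.
  rewrite inE negb_or eq_sym nyx /=.
  elim: p (y) pp {up Ez} => //= a p IH u /andP[/and3P[_ _ ax] pa].
  by rewrite inE negb_or eq_sym ax (IH _ pa).
have /cyc : ucycle (edge_rel A) (x :: y :: p).
  rewrite /ucycle cons_uniq xp up andbT /= rcons_path -Ez.
  rewrite arc_relW//= edge_rel_sym arc_relW// !andbT.
  by apply: (sub_path _ pp) => u v /and3P[].
by case: p {pp up xp} Ez nyz => //= ->; rewrite eqxx.
Qed.

Lemma converging_tree_root A C r y : converging_tree C A r -> (r, y) \notin A.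
Proof.
move=> [[AC _ _ acyc] rC Cr]; apply/negP => ry.
have yC : y \in C by move/fintype.subsetP: AC => /(_ _ ry); rewrite inE => /andP[].
by move: (acyclic_no_return acyc ry); rewrite Cr.
Qed.

Lemma converging_tree_arc_unique A C r x y z : converging_tree C A r ->
  (x, y) \in A -> (x, z) \in A -> y = z.
Proof.
move=> [[AC _ _ acyc] rC Cr] xy xz.
have inC w : (x, w) \in A -> w \in C.
  by move=> xw; move/fintype.subsetP: AC => /(_ _ xw); rewrite inE => /andP[].
by apply: (acyclic_arc_unique acyc xy xz); apply: Cr; apply: inC.
Qed.

Definition arcs (phi : {ffun V -> V}) : {set V * V} :=
  [set (x, phi x) | x in [set x | phi x != x]].

(** Inverse to [arcs] on loop-free sets with at most one arc out of each
vertex. *)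
Definition next_map H : {ffun V -> V} :=
  [ffun x => odflt x [pick y | (x, y) \in H]].

Lemma mem_arcs phi x y : ((x, y) \in arcs phi) = (phi x == y) && (x != y).
Proof.
apply/imsetP/andP => [[z + [-> ->]]|[/eqP <- nxy]].
  by rewrite inE eq_sym => ->.
by exists x; rewrite // inE eq_sym.
Qed.

Lemma arcsK : cancel arcs next_map.
Proof.
move=> phi; apply/ffunP => x; rewrite ffunE.
case: pickP => [y|no]; first by rewrite mem_arcs => /andP[/eqP].
by have := no (phi x); rewrite mem_arcs eqxx /= => /negbFE/eqP.
Qed.

Lemma next_mapK H : (forall x, (x, x) \notin H) ->
  (forall x y z, (x, y) \in H -> (x, z) \in H -> y = z) ->
  arcs (next_map H) = H.
Proof.
move=> loop det; apply/setP => -[x y]; rewrite mem_arcs ffunE.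
case: pickP => [z xz|no] /=; last first.
  by rewrite no; apply/andP => -[/eqP ->]; rewrite eqxx.
apply/andP/idP => [[/eqP <- _]//|xy]; split; first exact/eqP/(det x).
by apply: contraTneq xy => <-.
Qed.

Lemma next_map_root H r : (forall y, (r, y) \notin H) -> next_map H r = r.
Proof. by move=> rH; rewrite ffunE; case: pickP => // y; rewrite (negPf (rH y)). Qed.

Lemma connect_next_map H x y :
  (forall x y z, (x, y) \in H -> (x, z) \in H -> y = z) ->
  connect (arc_rel H) x y -> fconnect (next_map H) x y.
Proof.
move=> det; apply: connect_sub => u v uv; apply: connect1 => /=.
rewrite ffunE; case: pickP => [w uw|no] /=; first exact/eqP/(det u).
by move: uv; rewrite /arc_rel no.
Qed.

Lemma spanning_in_tree_next_map G r H : spanning_in_tree G r H ->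
  arcs (next_map H) = H /\ rooted_map [set r] (next_map H).
Proof.
move=> [_ HT]; have det := converging_tree_arc_unique HT.
have [[_ _ _ [loop _ _]] _ Hr] := HT; split; first exact: next_mapK.
apply/rooted_mapP; split=> [s /set1P ->|x].
  by apply: next_map_root => y; exact: converging_tree_root HT.
by exists r; rewrite ?inE//; apply: connect_next_map => //; apply: Hr.
Qed.

Lemma mem_weak_component H x : x \in weak_component H x.
Proof. by rewrite inE connect0. Qed.

Lemma weak_component_arc H C x y :
  C \in weak_components H -> (x, y) \in H -> (x \in C) = (y \in C).
Proof.
move=> /imsetP[z _ ->] xy; rewrite !inE.
have cl : fingraph.closed (edge_rel H) (connect (edge_rel H) z).
  by apply: connect_closed; apply/sym_connect_sym/edge_rel_sym.
by apply: cl; apply: arc_relW.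
Qed.

Lemma weak_component_eq H C x :
  C \in weak_components H -> x \in C -> weak_component H x = C.
Proof.
move=> /imsetP[z _ ->]; rewrite inE => zx; apply/setP => y; rewrite !inE.
have Hs := sym_connect_sym (@edge_rel_sym H).
by rewrite -(same_connect Hs zx).
Qed.

Lemma two_tree_in_forest_next_map G i j H : two_tree_in_forest G i j H ->
  arcs (next_map H) = H /\
  exists r, [/\ r != j, rooted_map [set r; j] (next_map H)
              & fconnect (next_map H) i r].
Proof.
move=> [[_ forH] card2 [C [C' [CH CH' nCC iC Cj]]]].
have indu D x y : D \in weak_components H -> x \in D -> (x, y) \in H ->
    (x, y) \in Defs.induced H D.
  by move=> DH xD xy; rewrite inE xy /= xD -(weak_component_arc DH xy).
have comp x : weak_component H x \in weak_components H by apply: finset.imset_f.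
have treex x := forH _ (comp x).
have det x y z : (x, y) \in H -> (x, z) \in H -> y = z.
  move=> xy xz; have [r Tr] := treex x.
  by apply: (converging_tree_arc_unique Tr (indu _ _ _ _ _ xy) (indu _ _ _ _ _ xz));
    rewrite ?comp ?mem_weak_component.
have loop x : (x, x) \notin H.
  have [r [[_ _ _ [lo _ _]] _ _]] := treex x; apply: contra (lo x).
  by apply: indu; rewrite ?comp ?mem_weak_component.
split; first exact: next_mapK.
have rootP D r : D \in weak_components H -> converging_tree D (Defs.induced H D) r ->
    next_map H r = r /\ forall x, x \in D -> fconnect (next_map H) x r.
  move=> DH Tr; have [_ rD Dr] := Tr; split.
    apply: next_map_root => y; apply: contra (converging_tree_root y Tr).
    exact: indu.
  move=> x xD; apply: connect_next_map => //; move: (Dr x xD).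
  apply: connect_sub => u v uv; apply: connect1.
  by move: uv; rewrite /arc_rel inE => /andP[].
have [r Tr] := forH _ CH.
have [fr Cr] := rootP _ _ CH Tr; have [fj C'j] := rootP _ _ CH' Cj.
have compsE : weak_components H = [set C; C'].
  apply/esym/eqP; rewrite eqEcard card2 cards2 nCC andbT.
  by apply/fintype.subsetP => D; rewrite !inE => /orP[]/eqP->.
exists r; split; last exact: Cr.
  apply: contra nCC => /eqP rj.
  have [_ rC _] := Tr; have [_ jC' _] := Cj; rewrite rj in rC.
  by rewrite -(weak_component_eq CH rC) (weak_component_eq CH' jC').
apply/rooted_mapP; split=> [s|x]; first by rewrite !inE => /orP[]/eqP->.
have := comp x; rewrite compsE !inE => /orP[]/eqP E.
  by exists r; rewrite ?inE ?eqxx//; apply: Cr; rewrite -E mem_weak_component.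
by exists j; rewrite ?inE ?eqxx ?orbT//; apply: C'j; rewrite -E mem_weak_component.
Qed.

Lemma undirected_acyclic_sub A (B : {set V * V}) : A \subset B ->
  undirected_acyclic B -> undirected_acyclic A.
Proof.
move=> /fintype.subsetP AB [loop two cyc]; split.
- by move=> x; apply: contra (loop x); apply: AB.
- by move=> x y xy; apply: contra (two _ _ (AB _ xy)); apply: AB.
- move=> c /andP[cA uc]; apply: cyc; rewrite /ucycle uc andbT.
  apply: sub_cycle cA => u v.
  by move=> /orP[]/AB uv; rewrite /edge_rel uv ?orbT.
Qed.

(** The number of vertices reachable from [x] serves as its height in the
forest. *)
Lemma rooted_reach_lt (S : {set V}) phi x : rooted_map S phi -> phi x != x ->
  (#|fconnect phi (phi x)| < #|fconnect phi x|)%N.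
Proof.
move=> /rooted_mapP[fS cS] nx; apply: proper_card; apply/fintype.properP; split.
  apply/fintype.subsetP => y; rewrite !inE => /(connect_trans _); apply.
  exact: fconnect1.
exists x; rewrite inE ?connect0//; apply: contra nx => xx.
have [s sS xs] := cS x.
by rewrite -(periodic_fixed (fS s sS) xs xx) fS.
Qed.

(** On an undirected cycle of length at least 3, the two neighbours of a vertex
of maximal height are distinct; but a neighbour that is not higher than [x] can
only be its successor. *)
Lemma arcs_acyclic (S : {set V}) phi :
  rooted_map S phi -> undirected_acyclic (arcs phi).
Proof.
move=> rphi; pose ht x := #|fconnect phi x|.
have htP x y : (x, y) \in arcs phi -> (ht y < ht x)%N.
  rewrite mem_arcs => /andP[/eqP <- nx].
  by apply: rooted_reach_lt rphi _; rewrite eq_sym.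
split=> [x|x y /htP xy|c uc].
- by rewrite mem_arcs eqxx andbF.
- by apply/negP => /htP; rewrite ltnNge ltnW.
- rewrite leqNgt; apply/negP => szc.
  have [x0 x0c] : exists x0, x0 \in c.
    by case: c szc {uc} => // x0 c _; exists x0; rewrite inE eqxx.
  case: (arg_maxnP ht x0c) => x xc maxx.
  have [m c' rotc] := rot_to xc.
  have nbr y : y \in c -> edge_rel (arcs phi) x y -> y = phi x.
    move=> yc /orP[|/htP yx]; last by have := maxx y yc; rewrite /= leqNgt yx.
    by rewrite mem_arcs => /andP[/eqP ->].
  have memc y : y \in x :: c' -> y \in c by rewrite -rotc mem_rot.
  have sz : size (x :: c') = size c by rewrite -rotc size_rot.
  move: uc; rewrite -(rot_ucycle m) rotc => /andP[].
  case: c' {rotc} memc sz => [|y [|z c']] memc sz; try by rewrite -sz in szc.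
  rewrite /cycle rcons_path => /andP[/andP[xy _] zx].
  rewrite edge_rel_sym in zx.
  have Ey : y = phi x by apply: nbr xy; apply: memc; rewrite !inE eqxx orbT.
  have Ez : last z c' = phi x.
    by apply: nbr zx; apply: memc; rewrite 2!in_cons /= mem_last !orbT.
  move=> /= /and3P[_ + _]; apply/negP; rewrite negbK Ey -Ez; exact: mem_last.
Qed.

Definition basin phi s : {set V} := [set x | fconnect phi x s].

Lemma mem_basin phi s : s \in basin phi s.
Proof. by rewrite inE connect0. Qed.

(** The tree of the forest rooted at [s] consists of the vertices that reach
[s]. *)
Lemma basin_converging_tree (S : {set V}) phi s :
  rooted_map S phi -> s \in S ->
  converging_tree (basin phi s) (Defs.induced (arcs phi) (basin phi s)) s.
Proof.
move=> rphi sS; have [fS cS] := rooted_mapP _ _ rphi; have fs := fS s sS.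
set B := basin phi s; set A := Defs.induced _ _.
have Bs x : x \in B -> connect (arc_rel A) x s.
  rewrite inE => /iter_findex; move: (findex _ _ _) => m.
  elim: m x => [|m IH] x /=; first by move=> ->; rewrite connect0.
  rewrite -iterS iterSr => xs.
  have [px|npx] := eqVneq (phi x) x.
    by have := IH x; rewrite -{1}px => /(_ xs).
  apply: connect_trans (IH _ xs); apply: connect1.
  have fxB : phi x \in B by rewrite inE -xs fconnect_iter.
  rewrite /arc_rel inE /= mem_arcs eqxx eq_sym npx fxB andbT /= inE.
  by rewrite fconnect_eqVf; move: fxB; rewrite inE => ->; rewrite orbT.
split; [split|exact: mem_basin|exact: Bs].
- by apply/fintype.subsetP => -[x y]; rewrite !inE => /andP[_ /andP[-> ->]].
- by apply/finset.set0Pn; exists s; apply: mem_basin.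
- have Be x : x \in B -> connect (edge_rel A) x s.
    move=> /Bs; apply: connect_sub => u v uv; apply: connect1.
    exact: arc_relW.
  move=> x y /Be xs /Be ys; apply: connect_trans xs _.
  by rewrite (sym_connect_sym (@edge_rel_sym A)).
- apply: undirected_acyclic_sub (arcs_acyclic rphi).
  by apply/fintype.subsetP => a; rewrite inE => /andP[].
Qed.

Lemma weak_component_basin (S : {set V}) phi s x :
  rooted_map S phi -> s \in S -> x \in basin phi s ->
  weak_component (arcs phi) x = basin phi s.
Proof.
move=> rphi sS xs; have [fS _] := rooted_mapP _ _ rphi; have fs := fS s sS.
have [[_ _ conn _] sB _] := basin_converging_tree rphi sS.
apply/setP => y; rewrite inE; apply/idP/idP => [xy|ys].
  have cl : fingraph.closed (edge_rel (arcs phi)) (basin phi s).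
    have cl u v : (u, v) \in arcs phi -> (u \in basin phi s) = (v \in basin phi s).
      rewrite mem_arcs => /andP[/eqP <- nu]; rewrite !inE fconnect_eqVf.
      by case: eqP => // us; rewrite us fs eqxx in nu.
    by move=> u v /orP[/cl|/cl].
  by rewrite -(closed_connect cl xy).
have := conn x y xs ys; apply: connect_sub => u v uv; apply: connect1.
by move: uv; rewrite /edge_rel !inE => /orP[]/andP[-> _]; rewrite ?orbT.
Qed.

Lemma arcs_spanning_in_tree G phi r : arcs phi \subset G ->
  rooted_map [set r] phi -> spanning_in_tree G r (arcs phi).
Proof.
move=> phiG rphi; split=> //.
have BT : basin phi r = [set: V].
  apply/setP => x; rewrite !inE; have [_ cS] := rooted_mapP _ _ rphi.
  by have [s /set1P ->] := cS x.
have := basin_converging_tree rphi (set11 r); rewrite BT.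
have -> // : Defs.induced (arcs phi) [set: V] = arcs phi.
by apply/setP => a; rewrite inE !finset.in_setT /= andbT.
Qed.

Lemma arcs_two_tree_in_forest G phi i r j : arcs phi \subset G -> r != j ->
  rooted_map [set r; j] phi -> fconnect phi i r ->
  two_tree_in_forest G i j (arcs phi).
Proof.
move=> phiG rj rphi ir.
have rS : r \in [set r; j] by rewrite !inE eqxx.
have jS : j \in [set r; j] by rewrite !inE eqxx orbT.
have [fS cS] := rooted_mapP _ _ rphi.
have compsE : weak_components (arcs phi) = [set basin phi r; basin phi j].
  apply/setP => C; rewrite !inE; apply/imsetP/idP => [[x _ ->]|].
    have [s sS xs] := cS x; rewrite (weak_component_basin rphi sS) ?inE//.
    by move: sS; rewrite !inE => /orP[]/eqP ->; rewrite eqxx ?orbT.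
  move=> /orP[]/eqP ->.
    by exists r; rewrite // (weak_component_basin rphi rS)// mem_basin.
  by exists j; rewrite // (weak_component_basin rphi jS)// mem_basin.
have nB : basin phi r != basin phi j.
  apply: contraNneq rj => E; have := mem_basin phi r; rewrite E inE.
  by move/(fconnect_fixed (fS r rS)) => ->.
split; [split=> // C| |].
- rewrite compsE !inE => /orP[]/eqP ->.
    by exists r; apply: basin_converging_tree rphi rS.
  by exists j; apply: basin_converging_tree rphi jS.
- by rewrite compsE cards2 nB.
- exists (basin phi r), (basin phi j); rewrite compsE !inE !eqxx orbT.
  by split=> //; apply: basin_converging_tree rphi jS.
Qed.

End TreeStructure.

(** * Forests against the fundamental matrix *)

Section ForestRepresentation.
Context {R : realType} {n : nat} (P : 'M[R]_n) (pi : 'rV[R]_n).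
Implicit Types (i j r : 'I_n).

Let p : 'I_n -> 'I_n -> R := fun x y => P x y.

Lemma weight_arcs (phi : {ffun 'I_n -> 'I_n}) :
  weight P (arcs phi) = map_weight p phi.
Proof.
rewrite /weight /arcs big_imset /= => [|x y _ _ [//]].
by apply: eq_bigl => x; rewrite inE.
Qed.

Hypothesis P_stochastic : stochastic P.

Lemma weight_off_digraph (H : {set 'I_n * 'I_n}) :
  ~~ (H \subset transition_digraph P) -> weight P H = 0.
Proof.
move=> /fintype.subsetPn[a aH]; rewrite inE => Pa.
rewrite /weight (bigD1 a)//=.
suff -> : P a.1 a.2 = 0 by rewrite mul0r.
by apply/eqP; rewrite eq_le (P_stochastic.1) andbT leNgt.
Qed.

(** Maps that use an arc of probability 0 have weight 0, so that the inclusion in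
the digraph of the chain can be dropped when summing over maps. *)
Lemma sum_weight_next_map (Q : pred {set 'I_n * 'I_n})
    (Q' : pred {ffun 'I_n -> 'I_n}) :
  (forall H, Q H -> arcs (next_map H) = H /\ Q' (next_map H)) ->
  (forall phi, arcs phi \subset transition_digraph P -> Q' phi -> Q (arcs phi)) ->
  \sum_(H | Q H) weight P H = \sum_(phi | Q' phi) map_weight p phi.
Proof.
move=> QQ' Q'Q; rewrite (reindex_onto arcs next_map) => [|H /QQ'[]//].
rewrite big_mkcond [RHS]big_mkcond; apply: eq_bigr => phi _.
rewrite arcsK eqxx andbT weight_arcs.
have [phiG|nphiG] := boolP (arcs phi \subset transition_digraph P); last first.
  by rewrite -weight_arcs weight_off_digraph// !if_same.
suff -> : Q (arcs phi) = Q' phi by [].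
by apply/idP/idP => [/QQ'[_]|/Q'Q->//]; rewrite arcsK.
Qed.

Lemma tree_weight_map j : tree_weight P j = tree_sum p j.
Proof.
apply: sum_weight_next_map => [H /asboolP/spanning_in_tree_next_map[-> ->]//|].
by move=> phi phiG rphi; apply/asboolP/arcs_spanning_in_tree.
Qed.

Lemma forest_weight_map i j : forest_weight P i j = forest_sum p i j.
Proof.
pose c r (phi : {ffun 'I_n -> 'I_n}) :=
  rooted_map [set r; j] phi && fconnect phi i r.
transitivity (\sum_(phi | [exists r, (r != j) && c r phi]) map_weight p phi).
  apply: sum_weight_next_map => [H /asboolP/two_tree_in_forest_next_map|].
    by move=> [-> [r [rj H1 H2]]]; split=> //; apply/existsP; exists r; apply/and3P.
  move=> phi phiG /existsP[r /and3P[rj rphi ir]].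
  by apply/asboolP; apply: arcs_two_tree_in_forest rphi ir.
rewrite /forest_sum (exchange_big_dep xpredT)//= big_mkcond.
apply: eq_bigr => phi _; case: existsP => [[r /andP[rj cr]]|nex].
  rewrite (bigD1 r) ?rj//= big1 ?addr0// => s /andP[/and3P[sj rs is_] sr].
  case/andP: cr => rr ir; have [fs _] := rooted_mapP _ _ rs.
  have [fr _] := rooted_mapP _ _ rr; move/negP: sr; case; apply/eqP.
  by apply: fconnect_fixed_unique is_ ir; [apply: fs|apply: fr];
    rewrite !inE eqxx.
by rewrite big1// => r cr; case: nex; exists r.
Qed.

Hypothesis P_irreducible : irreducible P.
Hypothesis pi_stationary : stationary_distribution P pi.

Lemma map_weight_ge0 phi : 0 <= map_weight p phi.
Proof. by apply: prodr_ge0 => x _; apply: P_stochastic.1. Qed.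

(** Send every vertex to a successor of positive probability that is strictly
closer to [j], the distance being the least [k] such that [P^k] can reach
[j]. *)
Lemma tree_sum_gt0 j : 0 < tree_sum p j.
Proof.
have ex x : exists k, 0 < (P ^+ k) x j by apply: P_irreducible.
pose d x := ex_minn (ex x).
have step x : x != j -> exists y, (0 < P x y) && (d y < d x)%N.
  move=> xj; rewrite {2}/d; case: ex_minnP => -[|k].
    by rewrite expr0 mxE (negPf xj) ltxx.
  rewrite exprS mxE => Pk _; apply/existsP; apply: contraTT Pk.
  rewrite negb_exists -leNgt => /forallP no; apply: sumr_le0 => y _.
  have Pxy := P_stochastic.1 x y.
  have Pkyj := stochastic_ge0_exp P_stochastic k y j.
  have := no y; rewrite negb_and -leNgt => /orP[Pxy0|].
    by have -> : P x y = 0; [apply/eqP; rewrite eq_le Pxy0|rewrite mul0r].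
  rewrite -leqNgt /d; case: ex_minnP => m _ mmin km.
  have -> : (P ^+ k) y j = 0.
    apply/eqP; rewrite eq_le Pkyj andbT leNgt; apply/negP => /mmin.
    by rewrite leqNgt km.
  by rewrite mulr0.
pose phi := [ffun x => if x == j then j else
  odflt x [pick y | (0 < P x y) && (d y < d x)%N]].
have phij : phi j = j by rewrite ffunE eqxx.
have phiP x : x != j -> (0 < P x (phi x)) && (d (phi x) < d x)%N.
  move=> xj; rewrite ffunE (negPf xj).
  by case: pickP => [//|no]; have [y] := step x xj; rewrite no.
have rphi : rooted_map [set j] phi.
  apply/rooted_mapP; split=> [s /set1P->//|x]; exists j; rewrite ?inE//.
  have [m] := ubnP (d x); elim: m x => // m IH x dx.
  have [->|xj] := eqVneq x j; first exact: connect0.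
  have /andP[_ lt] := phiP x xj.
  apply: connect_trans (fconnect1 _ _) (IH _ _).
  by rewrite (leq_trans lt).
rewrite /tree_sum (bigD1 phi)//= ltr_wpDr//.
  by apply: sumr_ge0 => psi _; apply: map_weight_ge0.
rewrite (rooted_map_weight _ rphi); apply: prodr_gt0 => x.
by rewrite inE => /phiP/andP[].
Qed.

Let q := \sum_j tree_sum p j.

(** [forest_sum_laplacian] and [forest_sum_laplacian_diag] put together, as one
equation for the operator [I - P]. *)
Lemma forest_sum_poisson i j :
  forest_sum p i j - \sum_k P i k * forest_sum p k j =
  tree_sum p j - q * (i == j)%:R.
Proof.
have [->|ij] := eqVneq i j.
  rewrite forest_sum_diag sub0r (forest_sum_laplacian_diag p j) mulr1.
  by rewrite /q [in RHS](bigD1 j)//= opprD addrA subrr sub0r.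
rewrite mulr0 subr0 -(forest_sum_laplacian p ij).
under [RHS]eq_bigr do rewrite mulrBr.
by rewrite sumrB -mulr_suml (P_stochastic.2 i) mul1r.
Qed.

(** The Markov chain tree theorem, obtained by pairing [forest_sum_poisson] with
the stationary distribution, which annihilates the left-hand side. *)
Lemma tree_sum_stationary j : tree_sum p j = q * pi 0 j.
Proof.
have [_ pi1 _] := pi_stationary.
have : \sum_i pi 0 i * (forest_sum p i j - \sum_k P i k * forest_sum p k j) = 0.
  exact: (stationary_laplacian pi_stationary (fun i => forest_sum p i j)).
under eq_bigr do rewrite forest_sum_poisson mulrBr.
rewrite sumrB -mulr_suml pi1 mul1r (bigD1 j)//= [X in _ - (_ + X)]big1.
  by rewrite eqxx mulr1 addr0 mulrC => /eqP; rewrite subr_eq0 => /eqP.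
by move=> i /negPf ->; rewrite !mulr0.
Qed.

(** The sum [f_(.,j) + q F . j] is harmonic: the point masses at [j] cancel, and
so do the constants because [q_j = q pi_j]. It is evaluated at [j], where
[f_(j,j) = 0]. *)
Lemma forest_sum_fundamental i j (F := fundamental_matrix P pi) :
  forest_sum p i j = q * (F j j - F i j).
Proof.
pose h : 'cV[R]_n := \col_i (forest_sum p i j + q * F i j).
have Ph : P *m h = h.
  apply/matrixP => k l; rewrite !mxE; apply/esym/eqP; rewrite -subr_eq0.
  under eq_bigr do rewrite mxE mulrDr mulrCA.
  rewrite big_split /= -mulr_sumr opprD addrACA forest_sum_poisson -mulrBr.
  rewrite (laplacian_fundamentalE P_stochastic P_irreducible pi_stationary).
  by rewrite tree_sum_stationary; apply/eqP; ring.
have := harmonic_constant P_stochastic P_irreducible Ph i j.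
rewrite !mxE forest_sum_diag add0r => E; rewrite mulrBr -E; ring.
Qed.

Lemma resistance_distance_forest i j :
  resistance_distance P pi i j =
  (forest_weight P i j + forest_weight P j i) / total_tree_weight P.
Proof.
have q0 : q != 0.
  rewrite gt_eqF// /q (bigD1 i)//= ltr_wpDr ?tree_sum_gt0//.
  by apply: sumr_ge0 => r _; rewrite ltW// tree_sum_gt0.
have -> : total_tree_weight P = q.
  by apply: eq_bigr => r _; rewrite tree_weight_map.
rewrite !forest_weight_map !forest_sum_fundamental /resistance_distance.
by field.
Qed.

End ForestRepresentation.

(** * Mean hitting times as survival series *)

Local Open Scope classical_set_scope.

Section HittingTime.
Context {R : realType} {n : nat} {d : measure_display} {T : measurableType d}.
Context (X : nat -> T -> 'I_n) (j : 'I_n).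

(** The event that the hitting time of [j] exceeds [m]. *)
Definition unhit m : set T := [set w | forall k, (k <= m)%N -> X k w <> j].

(** A hitting time counts the times at which [j] has not been hit yet. *)
Lemma hitting_time_series w :
  hitting_time X j w = (\sum_(m <oo) (\1_(unhit m) w)%:E)%E :> \bar R.
Proof.
have [[k Xk]|nohit] := pselect (exists k, X k w = j); last first.
  rewrite /hitting_time (_ : [set k | _] = set0); last first.
    by apply/seteqP; split=> // k /= Xk; apply: nohit; exists k.
  rewrite image_set0 ereal_inf0; apply/esym/eqyP => r r0.
  have [N rN] : exists N : nat, r <= N%:R.
    by exists (Num.truncn r).+1; rewrite ltW// truncnS_gt.
  apply: (@le_trans _ _ (N%:R)%:E); first by rewrite lee_fin.
  apply: le_trans (nneseries_lim_ge N _) => [|m _ _]; last by rewrite lee_fin.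
  rewrite sumEFin lee_fin big_mkord (eq_bigr (fun=> 1)) => [|m _].
    by rewrite sumr_const card_ord.
  by rewrite indicE mem_set// => k _ Xk; apply: nohit; exists k.
have exk : exists k, X k w == j by exists k; apply/eqP.
case: (ex_minnP exk) => K /eqP XK Kmin.
have -> : hitting_time X j w = (K%:R)%:E :> \bar R.
  apply/eqP; rewrite eq_le; apply/andP; split.
    by apply: ereal_inf_lbound; exists K.
  apply: le_ereal_inf_tmp => _ [l /= Xl <-]; rewrite lee_fin ler_nat.
  by apply: Kmin; apply/eqP.
rewrite (nneseries_split 0 K) => [|m _]; last by rewrite lee_fin.
rewrite add0n [X in (_ + X)%E]eseries0 => [|m Km _]; last first.
  by rewrite indicE memNset// => /(_ K Km).
rewrite adde0 sumEFin; congr _%:E; rewrite big_mkord (eq_bigr (fun=> 1)).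
  by rewrite sumr_const card_ord.
move=> m _; rewrite indicE mem_set// => l lm Xl.
have := Kmin l; rewrite Xl eqxx => /(_ isT).
by rewrite leqNgt (leq_ltn_trans lm).
Qed.

Context (P : 'M[R]_n) (Pr : probability T R).
Hypothesis X_markov : markov_chain P Pr X.

Lemma measurable_state k (B : set 'I_n) : measurable (X k @^-1` B).
Proof.
have -> : X k @^-1` B = \bigcup_(b in B) (X k @^-1` [set b]).
  apply/seteqP; split=> [w Bw|w [b Bb /= Xw]]; first by exists (X k w).
  by rewrite /preimage/= Xw.
apply: fin_bigcup_measurable => [|b _]; last exact: X_markov.1.
apply: sub_finite_set (finite_finpred (xpredT : pred 'I_n)).
by move=> b _ /=.
Qed.

Lemma measurable_states (B : nat -> set 'I_n) k :
  measurable [set w | forall m, (m <= k)%N -> B m (X m w)].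
Proof.
have -> : [set w | forall m, (m <= k)%N -> B m (X m w)] =
    \bigcap_(m in [set m | (m <= k)%N]) (X m @^-1` B m) by [].
by apply: bigcap_measurableType => m _; exact: measurable_state.
Qed.

Lemma total_probability (A : set T) s : measurable A ->
  Pr A = (\sum_l Pr (A `&` X s @^-1` [set l]))%E.
Proof.
move=> mA; rewrite -measure_bigsetU_ord => [|l|].
- congr (Pr _); rewrite -bigcup_seq; apply/seteqP; split=> [w Aw|w [l _ []//]].
  by exists (X s w) => //=; rewrite mem_index_enum.
- by apply: measurableI => //; exact: measurable_state.
- by move=> l l' _ _ [w [[_ /= <-] [_ /= <-]]].
Qed.

(** A history in which the first [s] states are only required to differ from
[j]. Increasing [s] one step at a time leads from the histories of the Markov
property to the event that [j] has been avoided so far. *)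
Definition avoid_history s (x : nat -> 'I_n) k : set T :=
  [set w | forall m, (m <= k)%N ->
     (if (m < s)%N then [set y | y <> j] else [set x m]) (X m w)].

Definition update (x : nat -> 'I_n) s l : nat -> 'I_n :=
  fun m => if m == s then l else x m.

Lemma measurable_avoid_history s x k : measurable (avoid_history s x k).
Proof.
exact: (measurable_states
  (fun m => if (m < s)%N then [set y | y <> j] else [set x m])).
Qed.

Lemma avoid_historyS s x k : (s <= k)%N ->
  Pr (avoid_history s.+1 x k) =
  (\sum_(l | l != j) Pr (avoid_history s (update x s l) k))%E.
Proof.
move=> sk; rewrite (total_probability s); last exact: measurable_avoid_history.
rewrite [RHS]big_mkcond; apply: eq_bigr => l _ /=.
case: eqVneq => [->|lj] /=.
  rewrite (_ : _ `&` _ = set0) ?measure0//; apply/seteqP; split=> // w [H /= Xs].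
  by have := H s sk; rewrite ltnSn /= Xs.
congr (Pr _); apply/seteqP; split=> [w [H /= Xs] m mk|w H].
  have := H m mk; rewrite /update ltnS leq_eqVlt.
  by case: eqVneq => //= -> _; rewrite ltnn.
have Xs : X s w = l by have := H s sk; rewrite ltnn /update eqxx.
split=> //= m mk; have := H m mk; rewrite /update (ltnS m s) (leq_eqVlt m s).
case: eqVneq => [->|_] /= => [_|//]; rewrite Xs; exact/eqP.
Qed.

(** The Markov property with the first [s] states summed out: both sides
decompose in the same way according to the value of the state at time [s]. *)
Lemma avoid_history_markov s x k : (s <= k)%N ->
  Pr (avoid_history s x k.+1) =
  (Pr (avoid_history s x k) * (P (x k) (x k.+1))%:E)%E.
Proof.
elim: s x => [|s IH] x sk; first exact: X_markov.2.
rewrite !avoid_historyS ?(ltnW sk)//; last exact: (leq_trans (ltnW sk)).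
rewrite ge0_sume_distrl => [|l _]; last exact: measure_ge0.
apply: eq_bigr => l _; rewrite IH ?(ltnW sk)// /update.
by rewrite gtn_eqF// gtn_eqF// ltnW.
Qed.

Lemma eq_avoid_history s x y k :
  (forall m, (s <= m <= k)%N -> x m = y m) ->
  avoid_history s x k = avoid_history s y k.
Proof.
move=> xy; apply/seteqP; split=> w H m mk; have := H m mk;
  by case: ltnP => // sm; rewrite xy// sm.
Qed.

Context (i : 'I_n).
Hypothesis X_start : starts_at Pr X i.

(** The law at time [k] of the chain killed after a visit to [j]: the mass sitting
at [j] is not transported further, hence the sum over [l' != j]. *)
Fixpoint killed k : 'I_n -> R :=
  if k is k'.+1 then fun l => \sum_(l' | l' != j) killed k' l' * P l' l
  else fun l => (l == i)%:R.

Lemma probability_killed k l :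
  Pr (avoid_history k (fun=> l) k) = (killed k l)%:E.
Proof.
elim: k l => [|k IH] l /=.
  have -> : avoid_history 0 (fun=> l) 0 = X 0 @^-1` [set l].
    by apply/seteqP; split=> [w H|w H [|//]]; [exact: (H 0%N)|].
  case: eqVneq => [->//|li]; apply/eqP; rewrite -measure_le0.
  have m0 y : measurable (X 0 @^-1` [set y]) by exact: measurable_state.
  have := probability_setC Pr (m0 i); rewrite X_start subee// => <-.
  apply: le_measure; rewrite ?inE//; first exact: measurableC.
  by move=> w /= -> il; rewrite il eqxx in li.
rewrite avoid_historyS// -sumEFin; apply: eq_bigr => l' _.
rewrite avoid_history_markov// EFinM -IH {2 3}/update eqxx gtn_eqF//.
congr (Pr _ * _)%E; apply: eq_avoid_history => m.
by rewrite -eqn_leq /update eq_sym => ->.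
Qed.

Lemma probability_unhit m : Pr (unhit m) = (\sum_(l | l != j) killed m l)%:E.
Proof.
have -> : unhit m = avoid_history m.+1 (fun=> i) m.
  by apply/seteqP; split=> w H k km; have := H k km; rewrite ltnS km.
rewrite avoid_historyS// -sumEFin; apply: eq_bigr => l _.
rewrite -probability_killed; congr (Pr _); apply: eq_avoid_history => k.
by rewrite -eqn_leq /update eq_sym => ->.
Qed.

Lemma measurable_unhit m : measurable (unhit m).
Proof. exact: (measurable_states (fun=> [set y | y <> j])). Qed.

Lemma integral_hitting_time :
  (\int[Pr]_w hitting_time X j w = \sum_(m <oo) Pr (unhit m))%E.
Proof.
under eq_integral do rewrite hitting_time_series.
rewrite integral_nneseries//.
- apply: eq_eseriesr => m _; rewrite integral_indic ?setIT//.
  exact: measurable_unhit.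
- move=> m; apply/measurable_realfun.measurable_EFinP.
  apply: measurable_realfun.measurable_indic; exact: measurable_unhit.
Qed.

Hypothesis P_ge0 : forall x y, 0 <= P x y.

Lemma killed_ge0 k l : 0 <= killed k l.
Proof.
elim: k l => [|k IH] l /=; first by rewrite ler0n.
by apply: sumr_ge0 => l' _; rewrite mulr_ge0.
Qed.

(** With [c m] the integral of [h] against the law at time [m] of the killed
chain, the equation for [h] gives [c m.+1 = c m - u m] for the survival
probability [u m], so the partial sums of [u] are [h i - c m]. They are bounded
since [|c m| <= K * u m <= K]; hence [u] tends to 0, and so does [c]. *)
Lemma sum_unhit (h : 'I_n -> R) : h j = 0 ->
  (forall x, x != j -> h x = 1 + \sum_y P x y * h y) ->
  (\sum_(m <oo) Pr (unhit m) = (h i)%:E)%E.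
Proof.
move=> hj hP.
pose u m := \sum_(l | l != j) killed m l.
pose c m := \sum_l killed m l * h l.
have c0 : c 0%N = h i.
  rewrite /c (bigD1 i)//= eqxx mul1r big1 ?addr0// => l /negPf ->.
  by rewrite mul0r.
have cS m : c m.+1 = c m - u m.
  rewrite /c /=; under eq_bigr do rewrite mulr_suml.
  rewrite exchange_big /= [in RHS](bigD1 j)//= hj mulr0 add0r -sumrB.
  apply: eq_bigr => x xj; rewrite (hP x xj) mulrDr mulr1 addrAC subrr add0r.
  by rewrite mulr_sumr; apply: eq_bigr => y _; rewrite mulrA.
have uE m : series u m = h i - c m.
  elim: m => [|m IH]; first by rewrite /series /= big_geq// c0 subrr.
  by rewrite seriesSr IH cS opprB addrA addrAC.
have u0 m : 0 <= u m by apply: sumr_ge0 => l _; exact: killed_ge0.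
have u1 m : u m <= 1.
  rewrite -lee_fin -probability_unhit; apply: probability_le1.
  exact: measurable_unhit.
pose K : R := \sum_l `|h l|.
have K0 : 0 <= K by apply: sumr_ge0.
have cK m : `|c m| <= K * u m.
  rewrite /c (bigD1 j)//= hj mulr0 add0r mulr_sumr.
  apply: le_trans (ler_norm_sum _ _ _) _; apply: ler_sum => l lj.
  rewrite normrM (ger0_norm (killed_ge0 _ _)) mulrC ler_wpM2r ?killed_ge0//.
  by rewrite /K (bigD1 l)//= lerDl; apply: sumr_ge0.
have cvu : cvgn (series u).
  apply: nondecreasing_is_cvgn.
    by apply/nondecreasing_seqP => m; rewrite seriesSr lerDl.
  exists (h i + K) => _ [m _ <-]; rewrite uE lerD2l.
  apply: (le_trans (ler_norm _)); rewrite normrN.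
  by apply: (le_trans (cK m)); rewrite ler_piMr.
have cvc : c @ \oo --> (0 : R).
  have cvKu : (fun m => K * u m) @ \oo --> (0 : R).
    rewrite -[0](mulr0 K); apply: cvgM; first exact: cvg_cst.
    exact: cvg_series_cvg_0.
  apply: (squeeze_cvgr (f := fun m => - (K * u m)) (h := fun m => K * u m)) => //.
    by apply: nearW => m; rewrite -ler_norml.
  by rewrite -[0]oppr0; exact: cvgN.
have cvs : series u @ \oo --> h i.
  rewrite (_ : series u = fun m => h i - c m); last exact/funext/uE.
  by rewrite -[X in _ --> X]subr0; apply: cvgB => //; exact: cvg_cst.
apply: cvg_lim => //.
rewrite (_ : (fun _ => _) = EFin \o series u).
  by apply: cvg_EFin => //; exact: nearW.
apply/funext => m /=; rewrite -sumEFin; apply: eq_bigr => l _.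
exact: probability_unhit.
Qed.

End HittingTime.

(** * Hitting times against the fundamental matrix *)

Section HittingRepresentation.
Context {R : realType} {n : nat} {d : measure_display} {T : measurableType d}.
Context (P : 'M[R]_n) (pi : 'rV[R]_n).
Context (X : nat -> T -> 'I_n) (Pr : 'I_n -> probability T R).
Hypothesis P_stochastic : stochastic P.
Hypothesis P_irreducible : irreducible P.
Hypothesis pi_stationary : stationary_distribution P pi.
Hypothesis X_markov : forall i, markov_chain P (Pr i) X.
Hypothesis X_start : forall i, starts_at (Pr i) X i.

Lemma mean_hitting_time_fundamental i j (F := fundamental_matrix P pi) :
  mean_hitting_time Pr X i j = ((F j j - F i j) / pi 0 j)%:E.
Proof.
have pij := stationary_gt0 P_stochastic P_irreducible pi_stationary j.
rewrite /mean_hitting_time (integral_hitting_time _ (X_markov i)).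
apply: (sum_unhit (X_markov i) (X_start i) P_stochastic.1
  (h := fun x => (F j j - F x j) / pi 0 j)) => [|x xj].
  by rewrite subrr mul0r.
under eq_bigr do rewrite mulrA mulrBr.
rewrite -mulr_suml sumrB -mulr_suml (P_stochastic.2 x) mul1r.
have := laplacian_fundamentalE P_stochastic P_irreducible pi_stationary x j.
rewrite (negPf xj) sub0r -/F => /(canRL (subrK _)) ->.
by field; rewrite gt_eqF.
Qed.

Lemma resistance_distance_hitting i j :
  (resistance_distance P pi i j)%:E =
  ((pi 0 j)%:E * mean_hitting_time Pr X i j +
   (pi 0 i)%:E * mean_hitting_time Pr X j i)%E.
Proof.
have pi_neq0 x : pi 0 x != 0.
  by rewrite gt_eqF// (stationary_gt0 P_stochastic P_irreducible pi_stationary).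
rewrite !mean_hitting_time_fundamental -!EFinM -EFinD; congr _%:E.
by rewrite /resistance_distance; field; rewrite !pi_neq0.
Qed.

(** The uniform distribution is stationary because the columns of [P] sum to
1. *)
Lemma doubly_stochastic_stationary j : doubly_stochastic P -> pi 0 j = n%:R^-1.
Proof.
move=> [_ col1]; have n0 : n%:R != 0 :> R.
  by rewrite pnatr_eq0 -lt0n (leq_ltn_trans _ (ltn_ord j)).
suff <- : const_mx n%:R^-1 = pi by rewrite mxE.
apply: (stationary_unique P_stochastic P_irreducible pi_stationary).
  under eq_bigr do rewrite mxE.
  by rewrite sumr_const card_ord -[_ *+ _]mulr_natl mulfV.
apply/rowP => k; rewrite !mxE; under eq_bigr do rewrite mxE.
by rewrite -mulr_sumr col1 mulr1.
Qed.

End HittingRepresentation.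

Theorem proposition1p1 (R : realType) (n : nat) (P : 'M[R]_n) (pi : 'rV[R]_n)
    (d : measure_display) (T : measurableType d)
    (X : nat -> T -> 'I_n) (Pr : 'I_n -> probability T R)
    (P_stochastic : stochastic P) (P_ergodic : ergodic P)
    (pi_stationary : stationary_distribution P pi)
    (X_markov : forall i, markov_chain P (Pr i) X)
    (X_start : forall i, starts_at (Pr i) X i)
    (i j : 'I_n) :
  let Omega := resistance_distance P pi in
  [/\ let D := group_inverse (1%:M - P) in
        Omega i j = D i i + D j j - D i j - D j i,
      (Omega i j)%:E = ((pi 0 j)%:E * mean_hitting_time Pr X i j +
                        (pi 0 i)%:E * mean_hitting_time Pr X j i)%E,
      Omega i j =
        (forest_weight P i j + forest_weight P j i) / total_tree_weight P
    & doubly_stochastic P ->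
        (Omega i j)%:E = ((n%:R^-1)%:E * commute_time Pr X i j)%E].
Proof.
have [P_irreducible _] := P_ergodic.
have hit := resistance_distance_hitting P_stochastic P_irreducible
  pi_stationary X_markov X_start i j.
split=> //.
- exact: resistance_distance_group_inverse.
- exact: resistance_distance_forest.
move=> dP; rewrite [LHS]hit /commute_time.
rewrite !(doubly_stochastic_stationary P_stochastic P_irreducible pi_stationary _ dP).
rewrite !(mean_hitting_time_fundamental P_stochastic P_irreducible
  pi_stationary X_markov X_start).
exact: (congr1 EFin (esym (mulrDr _ _ _))).
Qed.
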